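(* Let $(A,\circ,\alpha)$ be a Hom-Jordan algebra and let $R$ be a Rota-Baxter operator (of weight zero) on $A$. Then there is a Hom-pre-Jordan algebra structure $(A,\cdot,\alpha)$ on $A$ given by $$x\cdot y=R(x)\circ y,\qquad \forall x,y\in A.$$
   Context: All vector spaces are over a field $\mathbb{K}$ of characteristic $0$. A Hom-algebra is a triple $(A,\mu,\alpha)$ with $A$ a vector space, $\mu$ a bilinear multiplication on $A$, and $\alpha:A\to A$ a linear map. A Hom-Jordan algebra is a Hom-algebra $(A,\circ,\alpha)$ such that, for all $x,y\in A$, $x\circ y=y\circ x$ and $as_\alpha(x\circ x,\alpha(y),\alpha(x))=0$, where $as_\alpha(a,b,c)=(a\circ b)\circ\alpha(c)-\alpha(a)\circ(b\circ c)$. A Rota-Baxter operator of weight zero on a Hom-Jordan algebra $(A,\circ,\alpha)$ is an $\mathcal{O}$-operator associated to the adjoint representation, that is, a linear map $R:A\to A$ with $R\alpha=\alpha R$ and $R(x)\circ R(y)=R\big(R(x)\circ y+R(y)\circ x\big)$ for all $x,y\in A$. A Hom-pre-Jordan algebra is a Hom-algebra $(A,\cdot,\alpha)$ such that, writing (in this definition only) $x\circ y=x\cdot y+y\cdot x$, for all $x,y,z,u\in A$: $$[\alpha(x)\circ\alpha(y)]\cdot[\alpha(z)\cdot\alpha(u)]+[\alpha(y)\circ\alpha(z)]\cdot[\alpha(x)\cdot\alpha(u)]+[\alpha(z)\circ\alpha(x)]\cdot[\alpha(y)\cdot\alpha(u)]$$ $$=\alpha^2(x)\cdot[(y\circ z)\cdot\alpha(u)]+\alpha^2(y)\cdot[(z\circ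 x)\cdot\alpha(u)]+\alpha^2(z)\cdot[(x\circ y)\cdot\alpha(u)],$$ and $$[(x\circ z)\circ\alpha(y)]\cdot\alpha^2(u)+\alpha^2(x)\cdot[\alpha(y)\cdot(z\cdot u)]+\alpha^2(z)\cdot[\alpha(y)\cdot(x\cdot u)]$$ $$=\alpha^2(x)\cdot[(y\circ z)\cdot\alpha(u)]+\alpha^2(y)\cdot[(z\circ x)\cdot\alpha(u)]+\alpha^2(z)\cdot[(x\circ y)\cdot\alpha(u)].$$
   Formalization: The formal theorem additionally assumes that α is multiplicative, α(x∘y)=α(x)∘α(y); without this the claim fails for some Hom-Jordan algebras with α²=0 and α zero on products. *)

(* Defs.v *)
From mathcomp Require Import all_boot all_algebra.

Set Implicit Arguments.
Unset Strict Implicit.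
Unset Printing Implicit Defensive.

Import GRing.Theory.
Local Open Scope ring_scope.

(* A Hom-algebra (A, mu, alpha) over a field K is given by A : lmodType K,
   mu : {bilinear A -> A -> A} and alpha : {linear A -> A}. *)

Section HomAlgebra.
Variables (K : fieldType) (A : lmodType K).
Implicit Types (mu : {bilinear A -> A -> A}) (alpha R : {linear A -> A}).

(* This is the equivariance condition phi (rho(x) v) = rho(alpha x) (phi v) for
   rho = left multiplication and phi = alpha, i.e. what makes (A, L, alpha) an
   adjoint representation. It does not follow from [is_hom_jordan]. *)
Definition hom_multiplicative mu alpha : Prop :=
  forall x y : A, alpha (mu x y) = mu (alpha x) (alpha y).

Definition hom_associator mu alpha (a b c : A) : A :=
  mu (mu a b) (alpha c) - mu (alpha a) (mu b c).

Definition is_hom_jordan mu alpha : Prop :=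
  (forall x y : A, mu x y = mu y x) /\
  (forall x y : A, hom_associator mu alpha (mu x x) (alpha y) (alpha x) = 0).

Definition is_rota_baxter mu alpha R : Prop :=
  (forall x : A, R (alpha x) = alpha (R x)) /\
  (forall x y : A, mu (R x) (R y) = R (mu (R x) y + mu (R y) x)).

Definition is_hom_pre_jordan mu alpha : Prop :=
  let a := alpha in
  let j x y := mu x y + mu y x in
  forall x y z u : A,
    mu (j (a x) (a y)) (mu (a z) (a u))
    + mu (j (a y) (a z)) (mu (a x) (a u))
    + mu (j (a z) (a x)) (mu (a y) (a u))
    = mu (a (a x)) (mu (j y z) (a u))
      + mu (a (a y)) (mu (j z x) (a u))
      + mu (a (a z)) (mu (j x y) (a u))
    /\
    mu (j (j x z) (a y)) (a (a u))
    + mu (a (a x)) (mu (a y) (mu z u))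
    + mu (a (a z)) (mu (a y) (mu x u))
    = mu (a (a x)) (mu (j y z) (a u))
      + mu (a (a y)) (mu (j z x) (a u))
      + mu (a (a z)) (mu (j x y) (a u)).

End HomAlgebra.

(* Main.v *)
From HB Require Import structures.
Require Import Defs.
From mathcomp Require Import all_boot all_algebra.

Import GRing.Theory.
Local Open Scope ring_scope.

(** Write [∘] for the Hom-Jordan product, [x · y = R x ∘ y] for the new one, and
    [X = R x], [Y = R y], [Z = R z].  The Rota-Baxter identity says that [R]
    maps the anticommutator [x · y + y · x] to [X ∘ Y].  As [R] also commutes
    with [a = alpha], every term of the two Hom-pre-Jordan identities becomes an
    expression of degree four in [X, Y, Z, u] for the product [∘] alone, so both
    identities reduce to identities of Hom-Jordan algebras.

    The first one is [hom_jordan_linearized], the full linearization of the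
    Hom-Jordan axiom; multiplicativity of [a] rewrites the terms
    [a (x ∘ y) ∘ (a z ∘ a u)] of that linearization as
    [(a x ∘ a y) ∘ (a z ∘ a u)].  In this form its left-hand side is the sum over
    the three ways of splitting [x, y, z, u] into two pairs, so it is symmetric
    in all four variables.  Hence so is the right-hand side, of which only the
    symmetry in [x, y, z] is visible; exchanging [y] and [u] there produces the
    second identity, [hom_jordan_operator_identity].

    The characteristic enters only through the polarization of the Hom-Jordan
    axiom, where one divides by two. *)

(** The cyclic sum of [T] is half the trilinear part of [w |-> T w w w], the
    two halves being equal by the symmetry of [T] in its first two arguments.
    Replacing [v] by [- v] in the expansion of [T] at [u + v] separates the
    terms of bidegree (1, 2), and this costs only a division by two, not by
    three. *)
Lemma cyclic_sum_polarization (U V : zmodType) (T : U -> U -> U -> V)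
    (V_no_2_torsion : forall v : V, v + v = 0 -> v = 0)
    (TC : forall x y z, T x y z = T y x z)
    (TDl : forall y z, {morph (fun x => T x y z) : x x' / x + x'})
    (TDr : forall x y, {morph T x y : z z' / z + z'})
    (T_diag : forall x, T x x x = 0) (x y z : U) :
  T x y z + T y z x + T z x y = 0.
Proof.
have TDm u v v' w : T u (v + v') w = T u v w + T u v' w.
  by rewrite TC TDl !(TC u).
have TNl u v w : T (- u) v w = - T u v w.
  have T0 : T 0 v w = 0 by apply: (addIr (T 0 v w)); rewrite -TDl !add0r.
  by apply/eqP; rewrite -addr_eq0 -TDl addNr T0.
have TNm u v w : T u (- v) w = - T u v w by rewrite TC TNl TC.
have TNr u v w : T u v (- w) = - T u v w.
  have T0 : T u v 0 = 0 by apply: (addIr (T u v 0)); rewrite -TDr !add0r.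
  by apply/eqP; rewrite -addr_eq0 -TDr addNr T0.
(* the part of T (u + v) (u + v) (u + v) linear in u and quadratic in v *)
pose Q u v := T v v u + (T u v v + T u v v).
have Q_sum u v : Q u v + Q v u = 0.
  rewrite -[RHS](T_diag (u + v)) !(TDl, TDr, TDm) !T_diag.
  rewrite add0r addr0 /Q !(TC v u) !addrA.
  by rewrite [LHS](ACl (5*4*2*6*1*3)).
have Q0 u v : Q u v = 0.
  apply: V_no_2_torsion.
  have QN : Q u (- v) = Q u v by rewrite /Q !(TNl, TNr, TNm) !opprK.
  have NQ : Q (- v) u = - Q v u by rewrite /Q !(TNl, TNr, TNm) !opprD.
  rewrite -{2}QN -[LHS]addr0 -[X in _ + X](subrr (Q v u)).
  by rewrite addrACA -NQ [Q u (- v) + _]Q_sum Q_sum addr0.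
apply: V_no_2_torsion.
set S := T x y z + T y z x + T z x y.
have Q_add : Q x (y + z) = Q x y + Q x z + (S + S).
  rewrite /Q /S !(TDr, TDm, TDl) (TC z y) (TC z x) !addrA.
  by rewrite [LHS](ACl (1*5*9*4*8*12*7*2*6*11*3*10)).
by move: Q_add; rewrite !Q0 !add0r.
Qed.

Lemma lmod_no_2_torsion (K : fieldType) (charK0 : [pchar K] =i pred0)
    (A : lmodType K) (v : A) : v + v = 0 -> v = 0.
Proof.
move=> /eqP; rewrite -mulr2n -scaler_nat scaler_eq0.
by rewrite (pcharf0P K).1 //= => /eqP.
Qed.

Section HomJordan.
Variables (K : fieldType) (A : lmodType K).
Variables (mu : {bilinear A -> A -> A}) (alpha : {linear A -> A}).
Hypothesis charK0 : [pchar K] =i pred0.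
Hypothesis mu_mult : hom_multiplicative mu alpha.
Hypothesis mu_jordan : is_hom_jordan mu alpha.

Local Notation "x ∘ y" := (mu x y) (at level 40, left associativity).
Local Notation a := alpha.

(** Polarization applies to [T x y z = as_a (x ∘ y, a u, a z)], whose diagonal
    the Hom-Jordan axiom kills and which commutativity makes symmetric in [x]
    and [y]; multiplicativity then rewrites [a (x ∘ y)] as [a x ∘ a y], which
    exhibits the symmetry of the left-hand side in all four variables. *)
Lemma hom_jordan_linearized (x y z u : A) :
  (a x ∘ a y) ∘ (a z ∘ a u) + (a y ∘ a z) ∘ (a x ∘ a u)
    + (a z ∘ a x) ∘ (a y ∘ a u)
  = a (a x) ∘ ((y ∘ z) ∘ a u) + a (a y) ∘ ((z ∘ x) ∘ a u)
    + a (a z) ∘ ((x ∘ y) ∘ a u).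
Proof.
have [muC jordan] := mu_jordan.
pose T x y z := hom_associator mu a (x ∘ y) (a u) (a z).
have T_sum : T x y z + T y z x + T z x y = 0.
  apply: cyclic_sum_polarization; rewrite /T.
  - exact: lmod_no_2_torsion.
  - by move=> p q r; rewrite (muC p).
  - move=> q r p p'; rewrite /hom_associator !(linearDl, linearD) /=.
    by rewrite addrACA.
  - move=> p q r r'; rewrite /hom_associator !linearD /=.
    by rewrite addrACA.
  - by move=> p; apply: jordan.
move/eqP: T_sum; rewrite /T /hom_associator [X in X + _ == _]addrACA -opprD.
rewrite addrACA -opprD subr_eq0 => /eqP T_sum.
rewrite !mu_mult !(muC (a u)) in T_sum.
by rewrite !(muC (a (a _))) [RHS](ACl (3*1*2)).
Qed.

(** Exchanging [y] and [u] in [hom_jordan_linearized] permutes the terms of its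
    left-hand side; comparing the two right-hand sides gives this identity,
    which for [a = id] expresses the operator of multiplication by the triple
    product [(x ∘ z) ∘ y] through the operators of multiplication by [x], [y],
    [z] and by their pairwise products. *)
Lemma hom_jordan_operator_identity (x y z u : A) :
  ((x ∘ z) ∘ a y) ∘ a (a u) + a (a x) ∘ (a y ∘ (z ∘ u))
    + a (a z) ∘ (a y ∘ (x ∘ u))
  = a (a x) ∘ ((y ∘ z) ∘ a u) + a (a y) ∘ ((z ∘ x) ∘ a u)
    + a (a z) ∘ ((x ∘ y) ∘ a u).
Proof.
have [muC _] := mu_jordan.
have swap := hom_jordan_linearized x u z y.
rewrite -hom_jordan_linearized (muC x z) (muC _ (a (a u))) [LHS](ACl (2*1*3)).
rewrite !(muC (a y) (_ ∘ _)) (muC z u) -[LHS]swap.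
rewrite [LHS](ACl (2*1*3)) (muC (a u ∘ a z)) (muC (a x ∘ a u)).
by rewrite (muC (a u) (a z)) (muC (a z) (a y)) (muC (a u) (a y)).
Qed.

End HomJordan.

Section RotaBaxterProduct.
Variables (K : fieldType) (A : lmodType K).
Variables (mu : {bilinear A -> A -> A}) (R : {linear A -> A}).

Definition rota_baxter_mul (x y : A) : A := mu (R x) y.

Lemma rota_baxter_mul_bilinear :
  bilinear_for *:%R *:%R rota_baxter_mul.
Proof.
split=> [y | x] k v w; rewrite /rota_baxter_mul.
  by rewrite linearP linearPl.
by rewrite linearPr.
Qed.

HB.instance Definition _ :=
  bilinear_isBilinear.Build K A A A *:%R *:%R rota_baxter_mul
    rota_baxter_mul_bilinear.

End RotaBaxterProduct.

Theorem corollary2p1 (K : fieldType) (charK0 : [pchar K] =i pred0)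
    (A : lmodType K) (mu : {bilinear A -> A -> A}) (alpha R : {linear A -> A})
    (mu_mult : hom_multiplicative mu alpha)
    (mu_jordan : is_hom_jordan mu alpha)
    (R_rota_baxter : is_rota_baxter mu alpha R) :
  exists pmu : {bilinear A -> A -> A},
    (forall x y : A, pmu x y = mu (R x) y) /\ is_hom_pre_jordan pmu alpha.
Proof.
have [Ralpha RB] := R_rota_baxter.
exists (@rota_baxter_mul K A mu R); split=> // a j x y z u.
have Rj p q : R (j p q) = mu (R p) (R q) by rewrite RB.
have Ra p : R (a p) = a (R p) by exact: Ralpha.
rewrite /= /rota_baxter_mul !(Rj, Ra); split.
  exact: hom_jordan_linearized.
exact: hom_jordan_operator_identity.
Qed.
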